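(* Let $N\ge1$, $\nu_1>0$, $\nu_2>0$ be integers with $\nu_1+\nu_2\ge N$, and consider the $N$-round game of sampling without replacement from an urn with $\nu_1$ red and $\nu_2$ black balls. Let $S_N=x_1+\dots+x_N$ and let $\eta:\{0,\dots,N\}\to\mathbb R$ be any function. Then the upper and lower expected values of $\eta(S_N)$ coincide and are given by the expectation under the hypergeometric distribution: $$\overline{\mathbb E}(\eta(S_N))=\underline{\mathbb E}(\eta(S_N))=\sum_{m=\max(0,N-\nu_2)}^{\min(\nu_1,N)}\eta(m)\,\frac{\binom{\nu_1}{m}\binom{\nu_2}{N-m}}{\binom{\nu_1+\nu_2}{N}}.$$
   Context: Game of sampling without replacement: an initial capital $\mathcal K_0\in\mathbb R$ and $\nu_1,\nu_2$ are given, and $S_0=0$. In each round $n=1,\dots,N$, Forecaster announces $$p_n=\frac{\max(0,\nu_1-S_{n-1})}{\nu_1+\nu_2-(n-1)},$$ then Skeptic announces $M_n\in\mathbb R$, then Reality announces $x_n\in\{0,1\}$; Skeptic's capital is updated by $\mathcal K_n=\mathcal K_{n-1}+M_n(x_n-p_n)$ and $S_n=S_{n-1}+x_n$. A path is a sequence $\xi=x_1\dots x_N$ of Reality's moves. A strategy $\mathcal P$ of Skeptic specifies each $M_n$ as a function of Reality's previous moves $x_1,\dots,x_{n-1}$. $\mathcal K^{\mathcal P}_n(\xi)$ denotes Skeptic's capital after round $n$ along $\xi$ when he uses $\mathcal P$ with initial capital $0$. For a random variable, i.e. a real-valued function $x(\xi)$ of the path, $$\overline{\mathbb E}x=\inf\{\alpha\in\mathbb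 R \mid \exists\mathcal P\ \forall\xi:\ \mathcal K^{\mathcal P}_N(\xi)\ge x(\xi)-\alpha\},$$ $$\underline{\mathbb E}x=\sup\{\alpha\in\mathbb R \mid \exists\mathcal P\ \forall\xi:\ \mathcal K^{\mathcal P}_N(\xi)\ge \alpha-x(\xi)\}.$$ *)

(* Defs.v *)
From mathcomp Require Import all_boot all_order all_algebra.
From mathcomp Require Import all_classical all_reals ereal.

Set Implicit Arguments.
Unset Strict Implicit.
Unset Printing Implicit Defensive.

Import Order.TTheory GRing.Theory Num.Theory.
Local Open Scope ring_scope.

(* A path of the N-round game is an N.-tuple bool, true standing for the move 1
   (a red ball).  Rounds are numbered from 1, sequences from 0. *)

(* x_n, for 1 <= n <= N *)
Definition move (N : nat) (xi : N.-tuple bool) (n : nat) : nat :=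
  nth false xi n.-1.

Definition num_red (N : nat) (xi : N.-tuple bool) (n : nat) : nat :=
  (\sum_(1 <= i < n.+1) move xi i)%N.

Lemma num_red_lt (N : nat) (xi : N.-tuple bool) (n : nat) :
  (num_red xi n < n.+1)%N.
Proof.
rewrite ltnS /num_red big_add1 /=.
rewrite -[X in (_ <= X)%N](subn0 n) -[X in (_ <= X)%N]muln1 -sum_nat_const_nat.
by apply: leq_sum => i _; exact: leq_b1.
Qed.

(* S_N as an element of {0, ..., N} *)
Definition total_red (N : nat) (xi : N.-tuple bool) : 'I_N.+1 :=
  Ordinal (num_red_lt xi N).

(* p_n, for 1 <= n <= N *)
Definition forecast (R : realType) (nu1 nu2 N : nat) (xi : N.-tuple bool)
    (n : nat) : R :=
  Num.max 0 (nu1%:R - (num_red xi n.-1)%:R)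
    / (nu1%:R + nu2%:R - (n.-1)%:R).

(* M_n is the value of the strategy at the list [:: x_1; ...; x_(n-1)]; the
   round number is recovered from the length of that list. *)
Definition strategy (R : realType) := seq bool -> R.

Fixpoint capital (R : realType) (nu1 nu2 N : nat) (K0 : R) (P : strategy R)
    (xi : N.-tuple bool) (n : nat) : R :=
  if n is n'.+1 then
    capital nu1 nu2 K0 P xi n'
      + P (take n' xi) * ((move xi n)%:R - forecast R nu1 nu2 xi n)
  else K0.

(* The infimum and supremum are taken in the extended reals, so that an empty
   or unbounded set of prices does not receive a junk real value. *)
Definition upper_expectation (R : realType) (nu1 nu2 N : nat)
    (X : N.-tuple bool -> R) : \bar R :=
  ereal_inf [set a%:E | a in [set a : R | exists P : strategy R,
    forall xi : N.-tuple bool, X xi - a <= capital nu1 nu2 0 P xi N]].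

Definition lower_expectation (R : realType) (nu1 nu2 N : nat)
    (X : N.-tuple bool -> R) : \bar R :=
  ereal_sup [set a%:E | a in [set a : R | exists P : strategy R,
    forall xi : N.-tuple bool, a - X xi <= capital nu1 nu2 0 P xi N]].

(* Main.v *)
(** Skeptic can replicate the pay-off [eta S_N] exactly: he bets the difference
    of the two possible next values of the price process obtained from [eta] by
    backward induction.  This is an algebraic identity along every path, also
    along those on which the urn is overdrawn and the forecast leaves [[0, 1]].
    The initial price is the hypergeometric mean, since an exhausted colour gets
    forecast 0 and the values at overdrawn states never enter.  Conversely no
    strategy makes sure money: Reality answers a negative bet with 1 and any
    other bet with 0, except that she plays 1 once the black balls are exhausted,
    when the forecast is exactly 1.  A replicable pay-off in a game
    without sure gains has its replication price as upper and lower value. *)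

Require Import Defs.
From mathcomp Require Import all_boot all_order all_algebra.
From mathcomp Require Import all_classical all_reals ereal.
From mathcomp Require Import zify ring lra.

Import Order.TTheory GRing.Theory Num.Theory.
Local Open Scope ring_scope.

Lemma num_redS (N : nat) (xi : N.-tuple bool) n :
  num_red xi n.+1 = (num_red xi n + nth false xi n)%N.
Proof. by rewrite /num_red big_nat_recr. Qed.

Lemma num_red0 (N : nat) (xi : N.-tuple bool) : num_red xi 0 = 0%N.
Proof. by rewrite /num_red big_geq. Qed.

Lemma num_red_count (N : nat) (xi : N.-tuple bool) n :
  (n <= N)%N -> num_red xi n = count id (take n xi).
Proof.
elim: n => [|n IHn] lnN; first by rewrite num_red0 take0.
rewrite num_redS IHn ?(ltnW lnN)// (take_nth false) ?size_tuple//.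
by rewrite -cats1 count_cat /= addn0.
Qed.

(** The replies [g] are played out one round at a time; appending a move leaves earlier prefixes
    unchanged. *)
Lemma exists_path (g : seq bool -> bool) (N : nat) :
  exists xi : N.-tuple bool,
    forall n, (n < N)%N -> nth false xi n = g (take n xi).
Proof.
elim: N => [|N [xi xiP]]; first by exists [tuple].
exists [tuple of rcons xi (g xi)] => n; rewrite ltnS leq_eqVlt /=.
case/orP => [/eqP -> | lnN].
  by rewrite nth_rcons size_tuple ltnn eqxx -cats1 take_cat size_tuple ltnn
    subnn take0 cats0.
by rewrite nth_rcons size_tuple lnN xiP// -cats1 takel_cat// size_tuple ltnW.
Qed.

Section Capital.
Variables (R : realType) (nu1 nu2 N : nat).
Implicit Types (P Q : strategy R) (xi : N.-tuple bool).

Lemma capitalD P Q xi n :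
  capital nu1 nu2 0 (fun h => P h + Q h) xi n =
  capital nu1 nu2 0 P xi n + capital nu1 nu2 0 Q xi n.
Proof. by elim: n => [|n /= ->]; rewrite /= ?addr0//; ring. Qed.

Lemma capitalN P xi n :
  capital nu1 nu2 0 (fun h => - P h) xi n = - capital nu1 nu2 0 P xi n.
Proof. by elim: n => [|n /= ->]; rewrite /= ?oppr0//; ring. Qed.

Lemma no_sure_gain P : (N <= nu1 + nu2)%N ->
  exists xi, capital nu1 nu2 0 P xi N <= 0.
Proof.
move=> hN.
pose g h := (P h < 0) || (size h == nu2 + count id h)%N.
have [xi xiP] := exists_path g N; exists xi.
(* The invariant bounds the number of black balls drawn by nu2. *)
suff H n : (n <= N)%N ->
    capital nu1 nu2 0 P xi n <= 0 /\ (n <= nu2 + num_red xi n)%N.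
  by have [] := H N (leqnn N).
elim: n => [//|n IHn] lnN; have [Kn bn] := IHn (ltnW lnN).
rewrite num_redS /= /move /forecast /= xiP// /g size_take size_tuple lnN.
rewrite -num_red_count ?(ltnW lnN)//.
move: (num_red xi n) bn (P _) => s bn M.
have den : 0 < nu1%:R + nu2%:R - n%:R :> R.
  by rewrite subr_gt0 -natrD ltr_nat; lia.
set p := _ / _.
have p0 : 0 <= p by rewrite divr_ge0 ?le_max ?lexx// ltW.
(* By the invariant, the number [nu1 + nu2 - n] of balls left is at least [nu1 - s]. *)
have p1 : p <= 1.
  rewrite ler_pdivrMr// mul1r ge_max ltW//= lerBlDr.
  have : n%:R <= nu2%:R + s%:R :> R by rewrite -natrD ler_nat.
  lra.
have [M0|M0] /= := ltP M 0; first by split; [nra | lia].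
case: eqP => [nE|nE] /=; last by split; [nra | lia].
suff -> : p = 1 by split; [lra | lia].
rewrite /p max_r; last by rewrite subr_ge0 ler_nat; lia.
have -> : nu1%:R - s%:R = nu1%:R + nu2%:R - n%:R :> R.
  by rewrite nE natrD; ring.
by rewrite divff// gt_eqF.
Qed.

(** Combining a competing strategy [Q] with [P] or its negative cancels [X] and guarantees a
    difference of two prices, which [no_sure_gain] forces to be at most 0. *)
Lemma replicable_expectation (X : N.-tuple bool -> R) (e : R) P :
    (N <= nu1 + nu2)%N ->
    (forall xi, capital nu1 nu2 0 P xi N = X xi - e) ->
  upper_expectation nu1 nu2 X = e%:E /\ lower_expectation nu1 nu2 X = e%:E.
Proof.
move=> hN PX; split; apply/eqP; rewrite eq_le; apply/andP; split.
- by apply: ereal_inf_lbound; exists e => //; exists P => xi; rewrite PX.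
- apply: le_ereal_inf_tmp => _ [a [Q QX] <-]; rewrite lee_fin.
  have [xi] := no_sure_gain (fun h => Q h + - P h) hN.
  by rewrite capitalD capitalN PX; have := QX xi; lra.
- apply: ge_ereal_sup => _ [a [Q QX] <-]; rewrite lee_fin.
  have [xi] := no_sure_gain (fun h => Q h + P h) hN.
  by rewrite capitalD PX; have := QX xi; lra.
- apply: ereal_sup_ubound; exists e => //; exists (fun h => - P h) => xi.
  by rewrite capitalN PX; lra.
Qed.

End Capital.

Section Price.
Variables (R : realType) (nu1 nu2 : nat) (f : nat -> R).

Definition urn_prob (n s : nat) : R :=
  Num.max 0 (nu1%:R - s%:R) / (nu1%:R + nu2%:R - n%:R).

(* k rounds remain, n balls have been drawn, s of them red. *)
Fixpoint price (k n s : nat) : R :=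
  if k is k'.+1 then
    urn_prob n s * price k' n.+1 s.+1 + (1 - urn_prob n s) * price k' n.+1 s
  else f s.

Definition hedge (N : nat) : strategy R := fun h =>
  let n := size h in let s := count id h in
  price (N - n.+1) n.+1 s.+1 - price (N - n.+1) n.+1 s.

(** The price is the [p]-weighted average of its two successors, so a round changes it by exactly
    the bet times [x - p], and the gains telescope. *)
Lemma capital_hedge (N : nat) (xi : N.-tuple bool) n : (n <= N)%N ->
  capital nu1 nu2 0 (hedge N) xi n =
  price (N - n) n (num_red xi n) - price N 0 0.
Proof.
elim: n => [|n IHn] lnN /=; first by rewrite num_red0 subn0 subrr.
rewrite IHn ?(ltnW lnN)// /hedge size_take size_tuple lnN.
rewrite -num_red_count ?(ltnW lnN)// num_redS /forecast /move /=.
rewrite -(subnSK lnN) /= -/(urn_prob n (num_red xi n)).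
by case: (nth _ _ _); rewrite ?addn1 ?addn0 /=; ring.
Qed.

End Price.

Section Hypergeometric.
Variable R : realType.
Implicit Type g : nat -> R.

(** Unnormalised hypergeometric mean; the binomials vanish off the support. *)
Definition hyper_sum (k a b : nat) g : R :=
  \sum_(m < k.+1) g m * ('C(a, m)%:R * 'C(b, k - m)%:R).

Definition hyper_mean (k a b : nat) g : R := hyper_sum k a b g / 'C(a + b, k)%:R.

(* The weight k.+1 is split as m + (k.+1 - m); the two halves absorb into the
   red and the black binomial coefficient respectively. *)
Lemma hyper_sumS k a b g :
  k.+1%:R * hyper_sum k.+1 a b g =
  a%:R * hyper_sum k a.-1 b (g \o S) + b%:R * hyper_sum k a b.-1 g.
Proof.
have -> : k.+1%:R * hyper_sum k.+1 a b g =
    \sum_(m < k.+2) g m * ((m * 'C(a, m))%:R * 'C(b, k.+1 - m)%:R) +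
    \sum_(m < k.+2) g m * ('C(a, m)%:R * ((k.+1 - m) * 'C(b, k.+1 - m))%:R).
  rewrite -big_split mulr_sumr; apply: eq_bigr => m _ /=.
  rewrite !natrM (natrB _ (ltn_ord m : (m <= k.+1)%N)); ring.
congr (_ + _).
  rewrite big_ord_recl mul0n mul0r mulr0 add0r mulr_sumr.
  apply: eq_bigr => m _; rewrite /= /bump add1n subSS -mul_bin_diag natrM; ring.
rewrite big_ord_recr /= subnn mul0n !mulr0 addr0 mulr_sumr.
apply: eq_bigr => m _; rewrite subSn; last by rewrite -ltnS.
by rewrite -mul_bin_diag natrM; ring.
Qed.

(** Conditioning on the colour of the first ball drawn. *)
Lemma hyper_meanS k a b g : (k < a + b)%N ->
  hyper_mean k.+1 a b g =
  a%:R / (a + b)%:R * hyper_mean k a.-1 b (g \o S) +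
  b%:R / (a + b)%:R * hyper_mean k a b.-1 g.
Proof.
move=> lkab; rewrite /hyper_mean.
have binE : (a + b)%:R * 'C((a + b).-1, k)%:R = k.+1%:R * 'C(a + b, k.+1)%:R :> R.
  by rewrite -!natrM mul_bin_diag.
(* For an absent colour [.-1] truncates, but the factor in front is then 0. *)
have binl : a%:R / 'C(a.-1 + b, k)%:R = a%:R / 'C((a + b).-1, k)%:R :> R.
  by case: (a) => [|a']; rewrite ?mul0r// addSn.
have binr : b%:R / 'C(a + b.-1, k)%:R = b%:R / 'C((a + b).-1, k)%:R :> R.
  by case: (b) => [|b']; rewrite ?mul0r// addnS.
have ab0 : (a + b)%:R != 0 :> R by rewrite pnatr_eq0; lia.
have C0 : 'C((a + b).-1, k)%:R != 0 :> R by rewrite pnatr_eq0 -lt0n bin_gt0; lia.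
have C1 : 'C(a + b, k.+1)%:R != 0 :> R by rewrite pnatr_eq0 -lt0n bin_gt0; lia.
have k0 : k.+1%:R != 0 :> R by rewrite pnatr_eq0.
transitivity ((a%:R * hyper_sum k a.-1 b (g \o S) + b%:R * hyper_sum k a b.-1 g)
              / ((a + b)%:R * 'C((a + b).-1, k)%:R)).
  by rewrite -hyper_sumS binE invfM mulrACA divff// mul1r.
rewrite mulrDl !invfM; congr (_ + _).
  transitivity (hyper_sum k a.-1 b (g \o S) / (a + b)%:R *
                (a%:R / 'C((a + b).-1, k)%:R)); first ring.
  rewrite -binl; ring.
transitivity (hyper_sum k a b.-1 g / (a + b)%:R *
              (b%:R / 'C((a + b).-1, k)%:R)); first ring.
rewrite -binr; ring.
Qed.

(* a red and b black balls are left, s and t have been drawn. *)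
Lemma price_hyper_mean (f : nat -> R) k s t a b : (k <= a + b)%N ->
  price R (s + a) (t + b) f k (s + t) s = hyper_mean k a b (fun m => f (s + m)%N).
Proof.
elim: k s t a b => [|k IHk] s t a b lk.
  by rewrite /hyper_mean /hyper_sum big_ord1 /= !bin0 addn0 !mulr1 divr1.
rewrite hyper_meanS//=.
have -> : urn_prob R (s + a) (t + b) (s + t) s = a%:R / (a + b)%:R.
  rewrite /urn_prob max_r ?subr_ge0 ?ler_nat ?leq_addr// !natrD.
  by congr (_ / _); ring.
have ab0 : (a + b)%:R != 0 :> R by rewrite pnatr_eq0; lia.
have -> : 1 - a%:R / (a + b)%:R = b%:R / (a + b)%:R :> R.
  by move: ab0; rewrite natrD => ab0; field.
congr (_ + _).
(* With no red ball left, the overdrawn successor has weight 0. *)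
- case: a lk {ab0} => [|a] lk; first by rewrite !mul0r.
  rewrite -addSn -addSnnS IHk; last by lia.
  rewrite /hyper_mean /hyper_sum; do 2!congr (_ * _).
  by apply: eq_bigr => m _; rewrite /= addSnnS.
- case: b lk {ab0} => [|b] lk; first by rewrite !mul0r.
  by rewrite -addnS -(addSnnS t) IHk//; lia.
Qed.

End Hypergeometric.

Theorem mainTheorem3 (R : realType) (N nu1 nu2 : nat) (eta : 'I_N.+1 -> R)
    (hN : (1 <= N)%N) (hnu1 : (0 < nu1)%N) (hnu2 : (0 < nu2)%N)
    (hnu : (N <= nu1 + nu2)%N) :
  upper_expectation nu1 nu2 (fun xi => eta (total_red xi)) =
    lower_expectation nu1 nu2 (fun xi => eta (total_red xi)) /\
  lower_expectation nu1 nu2 (fun xi => eta (total_red xi)) =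
    (\sum_(m < N.+1 | (maxn 0 (N - nu2) <= m <= minn nu1 N)%N)
       eta m * (('C(nu1, m))%:R * ('C(nu2, N - m))%:R
                 / ('C(nu1 + nu2, N))%:R))%:E.
Proof.
(* [inord] takes a default value beyond [N], which no red count exceeds. *)
pose f m := eta (inord m).
have replicates (xi : N.-tuple bool) :
    capital nu1 nu2 0 (hedge R nu1 nu2 f N) xi N =
    eta (total_red xi) - price R nu1 nu2 f N 0 0.
  rewrite capital_hedge// subnn /= /f; congr (eta _ - _).
  by apply: val_inj; rewrite /= inordK ?num_red_lt.
have [-> ->] := replicable_expectation _ _ _ _ _ _ _ hnu replicates.
split=> //; congr (_%:E).
rewrite (price_hyper_mean R f N 0 0 nu1 nu2 hnu) /hyper_mean /hyper_sum.
rewrite mulr_suml [RHS]big_mkcond; apply: eq_bigr => m _.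
rewrite add0n /f inord_val.
case: ifPn => [_|out]; first by rewrite !mulrA.
(* Off the stated range one of the two binomials vanishes. *)
have /orP[h|h] : (nu1 < m)%N || (nu2 < N - m)%N by move: (ltn_ord m) out; lia.
  by rewrite [in 'C(nu1, m)]bin_small// mul0r mulr0 mul0r.
by rewrite [in 'C(nu2, N - m)]bin_small// !mulr0 mul0r.
Qed.
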